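(* Let $f_1, f_2,\ldots,f_m$ be mappings from $\mathbb{F}_{q^n}$ to $\mathbb{F}_q$, let $h_1, h_2, \ldots,h_m$ be permutation polynomials of $\mathbb{F}_q$, and let $A_1,\ldots,A_m$ be additive permutation polynomials over $\mathbb{F}_q$. Let $L:\mathbb{F}_{q^n}\rightarrow \mathbb{F}_{q^n}$ be an $\mathbb{F}_q$-linear polynomial with $\operatorname{Ker} L\cap \operatorname{Im} L=\{0\}$, and let $\gamma_1,\gamma_2,\ldots,\gamma_m$ be a basis for $\operatorname{Ker} L$ over $\mathbb{F}_q$. Suppose that for each $i\in\{1,\ldots,m\}$, $\gamma_i$ is a $(b_i, A_i)$-linear translator of $f_i$, where $b_i\in\mathbb{F}_q$ and $b_i\neq 0$, and a $(0, A_j)$-linear translator of $f_j$ for every $j\neq i$. Then $$F(x)=L(x)+\sum_{i=1}^{m}\gamma_ih_i(f_i(x))$$ is a permutation polynomial over $\mathbb{F}_{q^n}$ (i.e. $F$ permutes $\mathbb{F}_{q^n}$).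
   Context: $q$ is a prime power and $n,m$ are positive integers. An additive permutation polynomial over $\mathbb{F}_q$ is a polynomial $A(x)\in\mathbb{F}_q[x]$ that is additive, $A(x+y)=A(x)+A(y)$, and induces a permutation of $\mathbb{F}_q$. Let $f:\mathbb{F}_{q^n}\to\mathbb{F}_q$ be a function, $A$ an additive permutation polynomial over $\mathbb{F}_q$, and $b\in\mathbb{F}_q$ fixed. A nonzero element $\gamma\in\mathbb{F}_{q^n}$ is called a $(b,A)$-linear translator of $f$ if $f(x+u\gamma)-f(x)=bA(u)$ for all $x\in\mathbb{F}_{q^n}$ and all $u\in\mathbb{F}_q$. An $\mathbb{F}_q$-linear polynomial is one inducing an $\mathbb{F}_q$-linear map on $\mathbb{F}_{q^n}$; $\operatorname{Ker} L$ and $\operatorname{Im} L$ are the kernel and image of this map. *)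

(* Defs.v *)
From mathcomp Require Import all_boot all_order all_algebra all_field.

Set Implicit Arguments.
Unset Strict Implicit.
Unset Printing Implicit Defensive.

Import GRing.Theory.
Local Open Scope ring_scope.

Definition perm_poly (F : finFieldType) (h : {poly F}) : Prop :=
  bijective (fun x : F => h.[x]).

(* Additivity is required of the map induced by A on F; an identity
   A(X + Y) = A(X) + A(Y) between formal polynomials implies it. *)
Definition additive_perm_poly (F : finFieldType) (A : {poly F}) : Prop :=
  (forall x y : F, A.[x + y] = A.[x] + A.[y]) /\ perm_poly A.

Definition linear_translator (F : finFieldType) (E : fieldExtType F)
    (f : E -> F) (b : F) (A : {poly F}) (gamma : E) : Prop :=
  gamma != 0 /\
  forall (x : E) (u : F), f (x + u *: gamma) - f x = b * A.[u].

Definition linear_poly (F : finFieldType) (E : fieldExtType F)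
    (L : {poly E}) : Prop :=
  forall (a : F) (x y : E), L.[a *: x + y] = a *: L.[x] + L.[y].

(* linfun g agrees with g only when g is linear, so poly_lfun L is the map
   x |-> L(x) only under the hypothesis linear_poly L. *)
Definition poly_lfun (F : finFieldType) (E : fieldExtType F)
    (L : {poly E}) : 'End(E) :=
  linfun (fun x : E => L.[x]).

(* Main.v *)
Require Import Defs.
From HB Require Import structures.
From mathcomp Require Import all_boot all_order all_algebra all_field.

Set Implicit Arguments.
Unset Strict Implicit.
Unset Printing Implicit Defensive.

Import GRing.Theory.
Local Open Scope ring_scope.

(** Since the extension is finite, it suffices to show that the map is
    injective. The part of its value coming from L lies in Im L and the sum
    over the gamma_i lies in Ker L; as these subspaces meet trivially, two
    points x and y with the same value have L x = L y and equal sums. The first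
    equality says that x and y differ by an element of Ker L, say
    x = y + sum_i u_i gamma_i. The second, as the gamma_i are free and the h_i
    injective, says that f_i x = f_i y for every i. Moving from y to x one
    gamma_i at a time, only the step along gamma_i changes f_i, and it does so
    by b_i A_i(u_i) ([sum_of_translations]). Hence A_i(u_i) = 0, and u_i = 0
    because A_i is injective and vanishes at 0. *)

(** The hypothesis makes each increment independent of the base point, so the
    increments along successive steps add up. *)
Lemma sum_of_translations (V W : zmodType) (I : finType) (f : V -> W)
    (d : I -> V) (c : I -> W) :
    (forall i x, f (x + d i) - f x = c i) ->
  forall x, f (x + \sum_i d i) - f x = \sum_i c i.
Proof.
move=> fd; elim/big_rec2: _ => [|i w v _ IHv] x; first by rewrite addr0 subrr.
by rewrite addrA -(subrKA (f (x + d i))) IHv fd addrC.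
Qed.

Lemma inj_fieldExt_bij (F : finFieldType) (E : fieldExtType F) (g : E -> E) :
  injective g -> bijective g.
Proof. exact: (@injF_bij (finvect_type E)). Qed.

Lemma poly_lfunE (F : finFieldType) (E : fieldExtType F) (L : {poly E}) :
  linear_poly L -> poly_lfun L =1 horner L.
Proof.
move=> linL x; pose lin := GRing.isLinear.Build F E E *:%R (horner L) linL.
pose g : {linear E -> E} := HB.pack (horner L) lin.
exact: (lfunE g x).
Qed.

Lemma additive_perm_poly_eq0 (F : finFieldType) (A : {poly F}) (u : F) :
  additive_perm_poly A -> A.[u] = 0 -> u = 0.
Proof.
case=> addA /bij_inj injA Au0; apply: injA; rewrite Au0.
by apply: (addrI A.[0]); rewrite -addA !addr0.
Qed.

(** The vector g (x - y) = l - k lies in both the image and the kernel of g, so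
    it vanishes. *)
Lemma img_add_ker_inj (K : fieldType) (V : vectType K) (g : 'End(V))
    (x y k l : V) :
    (lker g :&: limg g = 0)%VS -> k \in lker g -> l \in lker g ->
  g x + k = g y + l -> x - y \in lker g /\ k = l.
Proof.
move=> kerIimg kerk kerl eq_xy.
have gxy : g (x - y) = l - k.
  by apply/eqP; rewrite linearB subr_eq addrAC eq_sym subr_eq addrC eq_xy addrC.
have gxy0 : g (x - y) = 0.
  apply/eqP; rewrite -memv0 -kerIimg memv_cap memv_img ?memvf // andbT.
  by rewrite gxy rpredB.
by split; [rewrite memv_ker gxy0 | apply/esym/eqP; rewrite -subr_eq0 -gxy gxy0].
Qed.

Theorem theorem3p7 (F : finFieldType) (E : fieldExtType F) (n m : nat)
  (n_gt0 : (0 < n)%N) (m_gt0 : (0 < m)%N) (dimE : \dim {:E} = n)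
  (f : 'I_m -> E -> F) (h A : 'I_m -> {poly F}) (b : 'I_m -> F)
  (L : {poly E}) (gamma : m.-tuple E)
  (h_perm : forall i, perm_poly (h i))
  (A_perm : forall i, additive_perm_poly (A i))
  (L_linear : linear_poly L)
  (L_ker_img : (lker (poly_lfun L) :&: limg (poly_lfun L) = 0)%VS)
  (gamma_basis : basis_of (lker (poly_lfun L)) gamma)
  (b_neq0 : forall i, b i != 0)
  (gamma_diag : forall i, linear_translator (f i) (b i) (A i) (tnth gamma i))
  (gamma_offdiag : forall i j, j != i ->
     linear_translator (f j) 0 (A j) (tnth gamma i)) :
  bijective (fun x : E =>
    L.[x] + \sum_(i < m) (h i).[f i x] *: tnth gamma i).
Proof.
apply: inj_fieldExt_bij => x y /=; rewrite -!(poly_lfunE L_linear) => eqF.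
have sum_ker (c : 'I_m -> F) :
    \sum_i c i *: tnth gamma i \in lker (poly_lfun L).
  apply: rpred_sum => i _; apply: rpredZ.
  exact: (basis_mem gamma_basis) (mem_tnth i gamma).
have [kerxy eq_sum] := img_add_ker_inj L_ker_img (sum_ker _) (sum_ker _) eqF.
have coord_sum (c : 'I_m -> F) i :
    coord gamma i (\sum_j c j *: tnth gamma j) = c i.
  under eq_bigr do rewrite (tnth_nth 0).
  exact: coord_sum_free (basis_free gamma_basis).
have eqf i : f i x = f i y.
  apply: (bij_inj (h_perm i)) => /=.
  by rewrite -(coord_sum (fun i => (h i).[f i x])) eq_sum coord_sum.
pose u i := coord gamma i (x - y).
have def_xy : x - y = \sum_i u i *: tnth gamma i.
  rewrite {1}(coord_basis gamma_basis kerxy).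
  by apply: eq_bigr => i _; rewrite (tnth_nth 0).
suff u0 i : u i = 0.
  by apply/eqP; rewrite -subr_eq0 def_xy big1 // => i _; rewrite u0 scale0r.
apply: (additive_perm_poly_eq0 (A_perm i)); apply: (mulfI (b_neq0 i)).
pose c j := if j == i then b i * (A i).[u i] else 0.
have step j z : f i (z + u j *: tnth gamma j) - f i z = c j.
  rewrite /c; case: eqVneq => [->|neq_ji]; first by case: (gamma_diag i) => _ ->.
  rewrite eq_sym in neq_ji.
  by case: (gamma_offdiag _ _ neq_ji) => _ ->; rewrite mul0r.
have := sum_of_translations step y.
rewrite -def_xy (addrC y) subrK eqf subrr -big_mkcond big_pred1_eq mulr0.
by move=> <-.
Qed.
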